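(* For any $h,v$ with $hv\ge n^2$ and $v\ge n$, there is an $[\alpha'+h,v]$-scheme for \textsc{MaxMatching} on $n$-vertex graphs, where $\alpha'=\alpha'(G)$ is the size of a maximum matching of the input graph $G$. In particular, there is an $[\alpha',n^2/\alpha']$-scheme.
   Context: Annotated streaming model (schemes): a space-bounded Verifier reads an input stream $\sigma$; after the stream ends, an all-powerful Prover sends a help message to the Verifier as a stream. A scheme for a function $f$ consists of the Verifier's randomized streaming algorithm, the honest Prover's help function, and the Verifier's output procedure, outputting a value in $\mathrm{range}(f)\cup\{\bot\}$ ($\bot$ = reject), with perfect completeness (honest help makes the Verifier output $f(\sigma)$ with probability 1) and soundness error at most $1/3$ (for every $\sigma$ and every help message, the probability of outputting a value outside $\{f(\sigma),\bot\}$ is at most $1/3$). An $[h,v]$-scheme uses $\tilde{O}(h)$ bits of help and $\tilde{O}(v)$ bits of Verifier space, where $\tilde{O}$ hides factors polynomial in $\log n$ (here the help cost may depend on the input through $\alpha'$). \textsc{MaxMatching}: the input is a graph $G$ on vertex set $[n]$ given as a stream of its edges; the desired output is $\alpha'(G)$, the cardinality of a maximum matching of $G$. *)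

(* Defs.v *)
From mathcomp Require Import all_boot all_order.
Set Implicit Arguments. Unset Strict Implicit. Unset Printing Implicit Defensive.

(* A stream token of the input: an edge {u,v} of a graph on vertex set [n],
   given as an (arbitrarily oriented) pair of vertices. *)
Definition edge_tok (n : nat) := ('I_n * 'I_n)%type.

Definition tok_set n (e : edge_tok n) : {set 'I_n} := [set e.1; e.2].

Definition valid_stream n (s : seq (edge_tok n)) : bool :=
  all (fun e => e.1 != e.2) s && uniq (map (@tok_set n) s).

Definition edgeset n (s : seq (edge_tok n)) : {set {set 'I_n}} :=
  [set e | e \in map (@tok_set n) s].

Definition is_matching n (E M : {set {set 'I_n}}) : bool :=
  (M \subset E) &&
  [forall e in M, forall f in M, (e != f) ==> [disjoint e & f]].

Definition max_matching n (s : seq (edge_tok n)) : nat :=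
  \max_(M : {set {set 'I_n}} | is_matching (edgeset s) M) #|M|.

(* A Verifier: a randomized streaming algorithm whose memory is a bit string.
   Randomness: a uniformly random seed of [seedlen] bits, used to choose the
   initial memory state.  It then reads the input stream token by token, then
   the Prover's help message bit by bit, and finally outputs [Some x] (the
   value x) or [None] (= reject, bottom). *)
Record verifier (n : nat) := Verifier {
  seedlen : nat;
  vinit : seedlen.-tuple bool -> seq bool;
  vstep : seq bool -> edge_tok n -> seq bool;
  vhelp : seq bool -> bool -> seq bool;
  vout  : seq bool -> option nat }.

Definition vstate n (V : verifier n) (r : (seedlen V).-tuple bool)
    (s : seq (edge_tok n)) (hm : seq bool) : seq bool :=
  foldl (vhelp V) (foldl (vstep V) (@vinit n V r) s) hm.
Arguments vstate {n} V r s hm.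

Definition vrun n (V : verifier n) (r : (seedlen V).-tuple bool)
    (s : seq (edge_tok n)) (hm : seq bool) : option nat :=
  vout V (vstate V r s hm).
Arguments vrun {n} V r s hm.

(* (V, P) is a scheme for f on n-vertex graphs: perfect completeness and
   soundness error at most 1/3 (probability over the uniform seed). *)
Definition is_scheme n (f : seq (edge_tok n) -> nat) (V : verifier n)
    (P : seq (edge_tok n) -> seq bool) : Prop :=
  (forall s, valid_stream s -> forall r, vrun V r s (P s) = Some (f s)) /\
  (forall s, valid_stream s -> forall hm : seq bool,
     3 * #|[set r : (seedlen V).-tuple bool |
              (vrun V r s hm != Some (f s)) && (vrun V r s hm != None)]|
     <= 2 ^ seedlen V).

Definition space_within n (V : verifier n) (S : nat) : Prop :=
  forall s, valid_stream s -> forall (hm : seq bool) r i j,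
    size (vstate V r (take i s) (take j hm)) <= S.

Definition help_within n (P : seq (edge_tok n) -> seq bool)
    (B : seq (edge_tok n) -> nat) : Prop :=
  forall s, valid_stream s -> size (P s) <= B s.

Definition polylog (c n : nat) : nat := (trunc_log 2 n).+1 ^ c.

(* Main.v *)
Require Import Defs.
From mathcomp Require Import all_boot all_order all_algebra.
From mathcomp Require Import zify.
Set Implicit Arguments. Unset Strict Implicit. Unset Printing Implicit Defensive.
Import GRing.Theory.

(* The help message certifies optimality of a matching M by Tutte-Berge duality:
   it contains a vertex set U and a partition of the vertices such that every
   edge meets U or lies inside a class, and #|M| = #|U| + sum over the classes C
   of floor(#|C|/2).  Singleton classes are left implicit, so this costs O(alpha')
   vertices.  What remains is to check that M lies in the stream and that every
   streamed edge is covered, i.e. that a nonnegative integer of size O(n^2), which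
   is linear in the edge indicator f, vanishes.  This is a sum-check modulo a prime
   p > n^2: write x = (x1, x2) with x2 in [b], b = v/n; the Verifier keeps the
   low-degree extension f~(r, x2, y) at a secret random r, and the Prover sends the
   univariate polynomial q(X) = sum_(x2, y) f~(X, x2, y) w~(X, x2, y), of degree
   O(n/b) = O(h), where w are the weights determined by M, U and the partition.
   As n <= v, the Verifier can afford to store the whole help message. *)

(** * Tutte-Berge duality *)

Definition simple_graph n (E : {set {set 'I_n}}) := forall e, e \in E -> #|e| = 2.

Definition matching_number n (E : {set {set 'I_n}}) : nat :=
  \max_(M : {set {set 'I_n}} | is_matching E M) #|M|.

Definition maximum_matching n (E M : {set {set 'I_n}}) : bool :=
  is_matching E M && (#|M| == matching_number E).

Lemma is_matchingE n (E M : {set {set 'I_n}}) :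
  is_matching E M = (M \subset E) && trivIset M.
Proof.
congr (_ && _); apply/forall_inP/trivIsetP => [H e f eM fM ef | H e eM].
  by have /forall_inP/(_ f fM)/implyP := H e eM; apply.
by apply/forall_inP => f fM; apply/implyP => ef; apply: H.
Qed.

Lemma leq_matching_number n (E M : {set {set 'I_n}}) :
  is_matching E M -> #|M| <= matching_number E.
Proof. exact: (@leq_bigmax_cond _ (is_matching E) (fun M : {set {set 'I_n}} => #|M|)). Qed.

Lemma maximum_matching_exists n (E : {set {set 'I_n}}) :
  exists M, maximum_matching E M.
Proof.
have m0 : is_matching E set0.
  rewrite is_matchingE sub0set /=; apply/trivIsetP => A B; by rewrite inE.
have [|M mM eM] := @eq_bigmax_cond _ (is_matching E) (fun M : {set {set 'I_n}} => #|M|).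
  by apply/card_gt0P; exists set0.
by exists M; rewrite /maximum_matching -eM eqxx andbT.
Qed.

Lemma is_matchingS n (E M N : {set {set 'I_n}}) :
  N \subset M -> is_matching E M -> is_matching E N.
Proof.
move=> NM; rewrite !is_matchingE => /andP[ME tM].
by rewrite (subset_trans NM ME) (trivIsetS NM).
Qed.

Lemma card_cover_matching n (E M : {set {set 'I_n}}) :
  simple_graph E -> is_matching E M -> #|cover M| = 2 * #|M|.
Proof.
rewrite is_matchingE => gE /andP[/subsetP ME /eqP <-].
by rewrite (eq_bigr (fun=> 2)) ?sum_nat_const 1?mulnC // => e /ME/gE.
Qed.

Lemma is_matchingU1 n (E M : {set {set 'I_n}}) e :
  simple_graph E -> is_matching E M -> e \in E -> [disjoint e & cover M] ->
  is_matching E (e |: M) /\ e \notin M.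
Proof.
rewrite !is_matchingE => gE /andP[ME tM] eE dM.
have /(_ e) [| |tU eM] := trivIsetU1 _ tM.
- move=> B BM; apply: disjointWr dM; exact: bigcup_sup.
- by apply/negP => /(subsetP ME)/gE; rewrite cards0.
by split=> //; rewrite tU andbT subUset sub1set eE.
Qed.

Definition never_both_missed n (E : {set {set 'I_n}}) (u v : 'I_n) : bool :=
  [forall M, maximum_matching E M ==> (u \notin cover M) ==>
     (v \notin cover M) ==> (u == v)].

Lemma never_both_missedP n (E : {set {set 'I_n}}) u v :
  reflect (forall M, maximum_matching E M -> u \notin cover M ->
             v \notin cover M -> u = v)
          (never_both_missed E u v).
Proof.
apply: (iffP forallP) => H M.
  by move=> mM uM vM; move: (H M); rewrite mM uM vM => /eqP.
by apply/implyP => mM; apply/implyP => uM; apply/implyP => vM; apply/eqP/(H M).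
Qed.

(* Gallai's lemma: if a maximum matching M missed both u and v, take N missing
   t with #|M :&: N| maximal; an alternating exchange would increase it. *)
Lemma never_both_missed_trans n (E : {set {set 'I_n}}) :
  simple_graph E ->
  (forall x, exists2 M, maximum_matching E M & x \notin cover M) ->
  transitive (never_both_missed E).
Proof.
move=> gE miss t u v /never_both_missedP Rut /never_both_missedP Rtv.
apply/never_both_missedP => M mxM uM vM; apply/eqP/negPn/negP => /eqP neq_uv.
have tM : t \in cover M.
  apply/negPn/negP => tM; apply: neq_uv.
  by rewrite (Rut M) // (Rtv M).
have [N0 mxN0 tN0] := miss t.
pose Q N := maximum_matching E N && (t \notin cover N).
have QN0 : Q N0 by rewrite /Q mxN0.
case: (@arg_maxnP _ N0 Q (fun N => #|M :&: N|) QN0) => N /andP[mxN tN] maxN.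
have uN : u \in cover N.
  apply/negPn/negP => uN; move: uM; by rewrite (Rut N) // tM.
have vN : v \in cover N.
  apply/negPn/negP => vN; move: vM; by rewrite -(Rtv N) // tM.
have [mM /eqP cM] := andP mxM; have [mN /eqP cN] := andP mxN.
(* Both matchings are maximum, so they cover equally many vertices. As [N] covers [u] and [v], which
   [M] misses, [M] covers at least two vertices that [N] misses, and one of them is not [t]. *)
have eqD : #|cover M :\: cover N| = #|cover N :\: cover M|.
  rewrite !cardsD (card_cover_matching gE mM) (card_cover_matching gE mN).
  by rewrite cM cN setIC.
have D2 : 1 < #|cover M :\: cover N|.
  rewrite eqD; apply: (@leq_trans #|[set u; v]|).
    by rewrite cards2; case: eqP neq_uv.
  by apply: subset_leq_card; rewrite subUset !sub1set !inE uM vM uN vN.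
have [x] : exists x, x \in (cover M :\: cover N) :\ t.
  apply/card_gt0P; move: D2; rewrite (cardsD1 t); by case: (_ \in _) => //; rewrite add0n => /ltnW.
rewrite !inE => /andP[xt /andP[xN /bigcupP[e eM xe]]].
have /andP[/subsetP ME tiM] : (M \subset E) && trivIset M by rewrite -is_matchingE.
have /andP[/subsetP NE tiN] : (N \subset E) && trivIset N by rewrite -is_matchingE.
have eE := ME _ eM.
have eN : e \notin N by apply: contra xN => eN; apply/bigcupP; exists e.
have [y ye yN] : exists2 y, y \in e & y \in cover N.
  apply/exists_inP; case: (boolP [exists y in e, y \in cover N]) => // /exists_inPn H.
  have dN : [disjoint e & cover N] by rewrite disjoint_subset; apply/subsetP => z; exact: H.
  have [m' e'] := is_matchingU1 gE mN eE dN.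
  by have := leq_matching_number m'; rewrite cardsU1 e' -cN ltnn.
have xy : x != y by apply: contra xN => /eqP->.
have exy : e = [set x; y].
  by apply/eqP; rewrite eq_sym eqEcard subUset !sub1set xe ye /= gE // cards2 xy.
have [f fN yf] := bigcupP yN.
have fM : f \notin M.
  apply/negP => fM; move: eN; suff -> : e = f by rewrite fN.
  by rewrite -(def_pblock tiM eM ye) (def_pblock tiM fM yf).
have mNf : is_matching E (N :\ f) by apply: is_matchingS mN; exact: subD1set.
have dNf : [disjoint e & cover (N :\ f)].
  rewrite coverD1 // disjoint_subset; apply/subsetP => z.
  by rewrite exy !inE => /orP[/eqP->|/eqP->]; rewrite ?(negbTE xN) ?yf ?andbF.
have [mN' eNf] := is_matchingU1 gE mNf eE dNf.
(* Exchanging [f] for [e] keeps [t] missed: [x] differs from [t], and [y] is covered by [N] while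
   [t] is not. The common part with [M] gains [e] and loses nothing, as [f] is not in [M]. *)
have QN' : Q (e |: (N :\ f)).
  rewrite /Q /maximum_matching mN' cardsU1 eNf.
  have -> : (1 + #|N :\ f|) = #|N| by rewrite (cardsD1 f N) fN.
  rewrite cN eqxx /=; apply/bigcupP => -[g]; rewrite !inE => /orP[/eqP->|/andP[_ gN] tg].
    rewrite exy !inE eq_sym (negbTE xt) /= => /eqP ty.
    by move: tN; rewrite ty yN.
  by move: tN => /bigcupP; apply; exists g.
have /= := maxN _ QN'; rewrite /geq /= leqNgt => /negP; apply; apply: proper_card.
apply/properP; split.
  apply/subsetP => g; rewrite !inE => /andP[gM gN]; rewrite gM gN andbT.
  by apply/orP; right; apply: contra fM => /eqP<-.
by exists e; rewrite !inE ?eqxx ?eM // (negbTE eN).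
Qed.

Lemma disjoint_setU1 (T : finType) (x : T) (A B : {set T}) :
  [disjoint x |: A & B] = (x \notin B) && [disjoint A & B].
Proof. by rewrite -setI_eq0 setIUl setU_eq0 !setI_eq0 disjoints1. Qed.

Definition covered n (U : {set 'I_n}) (L : 'I_n -> 'I_n) (x y : 'I_n) : bool :=
  [|| x \in U, y \in U | L x == L y].

(** The Tutte-Berge upper bound, the classes being the fibres of [L]. They partition all vertices,
    those of [U] included; a singleton contributes 0. *)
Definition cover_value n (U : {set 'I_n}) (L : 'I_n -> 'I_n) : nat :=
  #|U| + \sum_l #|[set x | L x == l]| %/ 2.

(** Weak duality: disjoint edges that meet [U] do so in distinct vertices, and a class contains at
    most half its size of disjoint edges. *)
Lemma leq_cover_value n (E M : {set {set 'I_n}}) U L :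
  simple_graph E -> (forall x y, [set x; y] \in E -> covered U L x y) ->
  is_matching E M -> #|M| <= cover_value U L.
Proof.
move=> gE covE mM; have /andP[/subsetP ME tM] : (M \subset E) && trivIset M.
  by rewrite -is_matchingE.
pose N l := [set e in M | e \subset [set x | L x == l]].
have N2 l : #|N l| <= #|[set x | L x == l]| %/ 2.
  rewrite leq_divRL // mulnC -(card_cover_matching gE (M := N l)).
    by apply/subset_leq_card/bigcupsP => e; rewrite inE => /andP[].
  by apply: is_matchingS mM; apply/subsetP => e; rewrite inE => /andP[].
have MN : M \subset (pblock M @: U) :|: \bigcup_l N l.
  apply/subsetP => e eM; have /eqP/cards2P[x [y [_ exy]]] := gE _ (ME _ eM).
  have : covered U L x y by apply: covE; rewrite -exy; exact: ME.
  have inU z : z \in e -> z \in U -> e \in pblock M @: U.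
    by move=> ze zU; apply/imsetP; exists z; rewrite ?(def_pblock tM eM ze).
  rewrite inE => /or3P[xU|yU|/eqP Lxy].
  - by rewrite (inU x) // exy !inE eqxx.
  - by rewrite (inU y) // exy !inE eqxx orbT.
  - apply/orP; right; apply/bigcupP; exists (L x) => //; rewrite inE eM exy.
    by rewrite subUset !sub1set !inE Lxy eqxx.
apply: leq_trans (subset_leq_card MN) _.
apply: leq_trans (leq_card_setU _ _) _; apply: leq_add; first exact: leq_imset_card.
have /leq_trans : #|\bigcup_l N l| <= \sum_l #|N l|.
  elim/big_rec2: _ => [|l k A _ IH]; first by rewrite cards0.
  by apply: leq_trans (leq_card_setU _ _) _; rewrite leq_add2l.
by apply; apply: leq_sum.
Qed.

Definition delete_vertices n (E : {set {set 'I_n}}) (U : {set 'I_n}) :=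
  [set e in E | [disjoint e & U]].

Lemma is_matching_delete n (E M : {set {set 'I_n}}) U :
  is_matching (delete_vertices E U) M =
  is_matching E M && [disjoint cover M & U].
Proof.
rewrite !is_matchingE andbAC; congr (_ && _).
apply/subsetP/andP => [H | [/subsetP ME dM] e eM].
  split; first by apply/subsetP => e /H; rewrite inE => /andP[].
  by rewrite disjoint_sym; apply: bigcup_disjoint => e /H; rewrite inE disjoint_sym => /andP[].
by rewrite inE ME //; apply: disjointWl dM; apply: bigcup_sup.
Qed.

(** A matching avoiding [x] is not maximum, and dropping the edge at [x] from a maximum one yields a
    matching that avoids [x]. So moving [x] into [U] costs exactly one edge. *)
Lemma matching_number_deleteU1 n (E : {set {set 'I_n}}) (U : {set 'I_n}) x :
  simple_graph E -> x \notin U ->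
  (forall M, maximum_matching (delete_vertices E U) M -> x \in cover M) ->
  (matching_number (delete_vertices E (x |: U))).+1 =
    matching_number (delete_vertices E U).
Proof.
move=> gE xU ess; set G := delete_vertices E U; set G' := delete_vertices E _.
apply/eqP; rewrite eqn_leq; apply/andP; split.
  have [M /andP[]] := maximum_matching_exists G'.
  rewrite is_matching_delete disjoint_sym disjoint_setU1 => /and3P[mM xM dM] /eqP <-.
  have mGM : is_matching G M by rewrite is_matching_delete mM disjoint_sym.
  rewrite ltn_neqAle leq_matching_number // andbT.
  by apply: contra xM => eM; apply: ess; rewrite /maximum_matching mGM.
have [M mxM] := maximum_matching_exists G; have [mGM /eqP <-] := andP mxM.
have /bigcupP[e eM xe] := ess _ mxM.
rewrite (cardsD1 e) eM add1n ltnS; apply: leq_matching_number.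
have := mGM; rewrite !is_matching_delete => /andP[mM dM].
have tM : trivIset M by move: mM; rewrite is_matchingE => /andP[].
rewrite (is_matchingS (subD1set _ _) mM) coverD1 //= disjoint_sym disjoint_setU1.
rewrite !inE xe /= disjoint_sym; apply: disjointWl dM; exact: subsetDl.
Qed.

(* U is chosen maximal with matching_number (E - U) + #|U| = matching_number E;
   then every vertex of E - U is missed by some maximum matching, and the
   classes of never_both_missed are the odd sets of the cover. *)
Theorem tutte_berge n (E : {set {set 'I_n}}) :
  simple_graph E ->
  exists U (L : 'I_n -> 'I_n),
    [/\ forall x y, [set x; y] \in E -> covered U L x y,
        matching_number E = cover_value U L &
        forall x, L (L x) = L x].
Proof.
move=> gE.
pose Q (U : {set 'I_n}) := matching_number (delete_vertices E U) + #|U| == matching_number E.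
have Q0 : Q set0.
  rewrite /Q cards0 addn0; apply/eqP; congr matching_number; apply/setP => e.
  by rewrite inE -setI_eq0 setI0 eqxx andbT.
case: (@arg_maxnP _ set0 Q (fun U : {set 'I_n} => #|U|) Q0) => U /eqP QU maxU.
set G := delete_vertices E U in QU.
have gG : simple_graph G by move=> e; rewrite inE => /andP[/gE].
have miss x : exists2 M, maximum_matching G M & x \notin cover M.
  apply/exists_inP; case: (boolP [exists M in maximum_matching G, x \notin cover M]) => //.
  move=> /exists_inPn H.
  have ess M : maximum_matching G M -> x \in cover M by move=> /H; rewrite negbK.
  (* A vertex of [U] is isolated in [G], so no matching of [G] covers it. Any other vertex covered
     by all maximum matchings could join [U], against maximality. *)
  case: (boolP (x \in U)) => xU.
    have [M mxM] := maximum_matching_exists G; have xM := ess _ mxM.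
    move: mxM; rewrite /maximum_matching is_matching_delete => /andP[/andP[_ dM] _].
    by move: (disjointFr dM xM); rewrite xU.
  have := matching_number_deleteU1 gE xU ess => eG.
  have /maxU /= : Q (x |: U) by rewrite /Q cardsU1 xU add1n addnS -addSn eG QU.
  by rewrite /geq /= cardsU1 xU ltnn.
pose R := never_both_missed G.
have Rt : transitive R by apply: never_both_missed_trans.
have Rs : symmetric R.
  move=> x y; apply/never_both_missedP/never_both_missedP => H M *; symmetry; exact: (H M).
have Rr : reflexive R by move=> x; apply/never_both_missedP.
have RG x y : [set x; y] \in G -> R x y.
  move=> xyG; apply/never_both_missedP => M /andP[mM /eqP cM] xM yM.
  have d : [disjoint [set x; y] & cover M] by rewrite disjoint_setU1 xM disjoints1.
  have [m' e'] := is_matchingU1 gG mM xyG d.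
  by have := leq_matching_number m'; rewrite cardsU1 e' -cM ltnn.
pose L x := odflt x [pick y | R x y].
have RL x : R x (L x) by rewrite /L; case: pickP => //= _; apply: Rr.
have LR x y : R x y -> L x = L y.
  move=> Rxy; rewrite /L (@eq_pick _ (R x) (R y)); last first.
    by move=> z; apply/idP/idP => [|/(Rt _ _ _ Rxy)//]; apply: Rt; rewrite Rs.
  by case: pickP => // /(_ y); rewrite Rr.
have RLP x y : L x = L y -> R x y.
  by move=> e; apply: Rt (RL x) _; rewrite e Rs.
have cov x y : [set x; y] \in E -> covered U L x y.
  move=> xyE; rewrite /covered; case: (boolP (x \in U)) => //= xU.
  case: (boolP (y \in U)) => //= yU; apply/eqP/LR/RG; rewrite inE xyE.
  by rewrite disjoint_setU1 xU disjoints1.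
exists U, L; split => //; last by move=> x; symmetry; apply: LR.
apply/eqP; rewrite eqn_leq; apply/andP; split.
  by have [M /andP[mM /eqP <-]] := maximum_matching_exists E; apply: leq_cover_value mM.
rewrite -QU [X in _ <= X]addnC leq_add2l.
have [M mxM] := maximum_matching_exists G; have [mM /eqP <-] := andP mxM.
have /andP[/subsetP MG tM] : (M \subset G) && trivIset M by rewrite -is_matchingE.
pose C l := [set x | L x == l].
(* [M] misses at most one vertex of a class, and its edges do not leave their class, so [M] has at
   least floor(#|C l|/2) edges inside [C l]. *)
have half l : #|C l| %/ 2 <= \sum_(e in M) (e \subset C l).
  pose N := [set e in M | e \subset C l].
  have -> : \sum_(e in M) (e \subset C l) = #|N|.
    rewrite -sum1_card big_mkcond [RHS]big_mkcond; apply: eq_bigr => e _.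
    by rewrite inE; case: (e \in M); case: (e \subset C l).
  have mN : is_matching G N by apply: is_matchingS mM; apply/subsetP => e; rewrite inE => /andP[].
  have C1 : #|C l :\: cover M| <= 1.
    apply/card_le1P => x; rewrite !inE => /andP[xM /eqP Lx] y; rewrite !inE.
    apply/andP/eqP => [[yM /eqP Ly]|->]; last by rewrite Lx eqxx.
    by have /never_both_missedP := RLP y x (etrans Ly (esym Lx)); apply; eauto.
  have C2 : #|C l :&: cover M| <= 2 * #|N|.
    rewrite -(card_cover_matching gG mN); apply/subset_leq_card/subsetP => x.
    rewrite !inE => /andP[/eqP Lx /bigcupP[e eM xe]].
    apply/bigcupP; exists e => //; rewrite inE eM; apply/subsetP => y ye.
    rewrite inE -Lx eq_sym; apply/eqP.
    have [-> //|xy] := eqVneq x y.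
    apply/LR/RG; suff <- : e = [set x; y] by apply: MG.
    by apply/eqP; rewrite eq_sym eqEcard subUset !sub1set xe ye /= gG ?MG // cards2 xy.
  rewrite -ltnS ltn_divLR //; apply: (@leq_ltn_trans (2 * #|N| + 1)).
    by rewrite -(cardsID (cover M) (C l)) leq_add.
  by rewrite [_.+1 * 2]mulSn mulnC addn1 add2n.
apply: (@leq_trans (\sum_l \sum_(e in M) (e \subset C l))).
  by apply: leq_sum => l _; exact: half.
rewrite exchange_big /= -sum1_card; apply: leq_sum => e eM.
have /eqP/cards2P[x [y [_ exy]]] := gG _ (MG _ eM).
rewrite (bigD1 (L x)) //= big1 ?addn0 ?leq_b1 // => l lx.
by rewrite exy subUset sub1set inE eq_sym (negbTE lx).
Qed.

(** * A prime in a short interval *)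

Lemma sum_nat_leq_indicator (K m : nat) : \sum_(1 <= i < m.+1) (i <= K) <= K.
Proof.
suff : \sum_(1 <= i < m.+1) (i <= K) <= minn m K by move/leq_trans; apply; exact: geq_minr.
elim: m => [|m IH]; first by rewrite big_geq.
rewrite big_nat_recr //=; apply: leq_trans (leq_add IH (leqnn _)) _.
case: (leqP m.+1 K) => [mK|mK]; last by rewrite addn0 geq_minr.
by rewrite (minn_idPl (ltnW mK)) addn1.
Qed.

(** By Legendre's formula the exponent is the sum of floor(2N/p^k) - 2 floor(N/p^k), where each term
    is at most 1 and vanishes once p^k exceeds 2N. *)
Lemma logn_central_bin (N p : nat) :
  0 < N -> prime p -> logn p 'C(N.*2, N) <= trunc_log p N.*2.
Proof.
move=> N0 pp; set e := trunc_log p N.*2.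
have p1 := prime_gt1 pp; have p0 := prime_gt0 pp.
have C0 : 0 < 'C(N.*2, N) by rewrite bin_gt0 -addnn leq_addr.
have /(congr1 (logn p)) : 'C(N.*2, N) * (N`! * N`!) = N.*2`!.
  by rewrite -(@bin_fact N.*2 N) -addnn ?leq_addr // addnK.
rewrite !lognM ?muln_gt0 ?fact_gt0 // !logn_fact //.
have ext : \sum_(1 <= k < N.+1) N %/ p ^ k = \sum_(1 <= k < N.*2.+1) N %/ p ^ k.
  rewrite [RHS](@big_cat_nat _ _ _ N.+1) //=; last by rewrite ltnS -addnn leq_addr.
  rewrite [X in _ = _ + X]big1_seq ?addn0 // => k; rewrite mem_index_iota => /andP[_ /andP[Nk _]].
  by rewrite divn_small //; apply: leq_trans (ltn_expl k p1); exact: ltnW.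
rewrite ext addnn => E.
have : \sum_(1 <= k < N.*2.+1) N.*2 %/ p ^ k <=
       \sum_(1 <= k < N.*2.+1) ((k <= e) + (N %/ p ^ k).*2).
  rewrite big_nat_cond [X in _ <= X]big_nat_cond; apply: leq_sum => k /andP[/andP[k0 _] _].
  have pk : 0 < p ^ k by rewrite expn_gt0 p0.
  case: (leqP k e) => ke; last first.
    by rewrite divn_small //; apply: leq_trans (trunc_log_ltn N.*2 p1) _; rewrite leq_exp2l.
  rewrite add1n -ltnS ltn_divLR // {1}(divn_eq N (p ^ k)) doubleD !mulSn -doubleMl.
  by rewrite addnA addnn addnC ltn_add2r ltn_double ltn_mod.
rewrite big_split /= -E -(big_morph double doubleD (erefl 0.*2)) leq_add2r.
by move/leq_trans; apply; exact: sum_nat_leq_indicator.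
Qed.

Lemma central_bin_ge (N : nat) : 2 ^ N <= 'C(N.*2, N).
Proof.
elim: N => [|N IH] //.
rewrite doubleS binS expnS mul2n -addnn leq_add //; apply: leq_trans IH _.
  by rewrite binS leq_addl.
by apply: leq_bin2l.
Qed.

(** A weak Bertrand postulate in Chebyshev's manner. With N = K^2 and no prime in (K, 2N], the
    central binomial coefficient has at most K prime power factors, each at most 2N, so it is at
    most (2N)^K. But it is at least 2^N = (2^K)^K, and 2K^2 < 2^K from K = 7 on. *)
Lemma prime_below_double_square (K : nat) : 7 <= K ->
  exists p, [&& prime p, K < p & p <= (K ^ 2).*2].
Proof.
move=> K7; set N := K ^ 2.
case: (boolP (has (fun p => prime p && (K < p)) (iota 0 N.*2.+1))).
  case/hasP => p; rewrite mem_iota add0n ltnS => /andP[_ pN] /andP[pp Kp].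
  by exists p; rewrite pp Kp.
move=> /hasPn H; exfalso.
have N0 : 0 < N by rewrite expn_gt0 (leq_trans _ K7).
set B := 'C(N.*2, N).
have B0 : 0 < B by rewrite bin_gt0 -addnn leq_addr.
have : B <= N.*2 ^ K.
  rewrite -{1}(partnT B0) (widen_partn _ (leqnn B)).
  apply: (@leq_trans (\prod_(0 <= p < B.+1) N.*2 ^ ((0 < p) && (p <= K)))).
    apply: leq_prod => p _; case: (boolP (prime p)) => pp; last first.
      by rewrite lognE (negbTE pp) expn0 expn_gt0 double_gt0 N0.
    have lp := logn_central_bin N0 pp; have p0 := prime_gt0 pp.
    rewrite p0 /=; case: (leqP p K) => pK; last first.
      suff -> : logn p B = 0 by [].
      apply/eqP; rewrite -leqn0; apply: leq_trans lp _; rewrite leqn0 trunc_log_eq0.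
      apply/orP; right; rewrite -ltnS prednK // ltnNge; apply/negP => pN.
      by have := H p; rewrite mem_iota add0n ltnS pN pp pK => /(_ isT).
    rewrite expn1; apply: leq_trans (trunc_logP (prime_gt1 pp) _); last by rewrite double_gt0.
    by rewrite leq_exp2l // prime_gt1.
  rewrite -expn_sum leq_pexp2l ?double_gt0 // big_ltn //= add0n.
  rewrite big_nat_cond (eq_bigr (fun p => (p <= K) : nat)) -?big_nat_cond.
    exact: sum_nat_leq_indicator.
  by move=> p /andP[/andP[-> _] _].
rewrite leqNgt => /negP; apply; apply: leq_trans (central_bin_ge N).
rewrite /N -mulnn expnM ltn_exp2r; last exact: leq_trans K7.
rewrite mulnn => {H N0 B B0 N}.
elim: K K7 => // K IH; rewrite leq_eqVlt => /predU1P[<- //|]; rewrite ltnS => K7.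
rewrite [2 ^ _.+1]expnS mul2n; apply: leq_trans (_ : (K ^ 2).*2.*2 < _); last by rewrite ltn_double IH.
rewrite ltnS leq_double -!mulnn -addnn mulSn mulnS.
rewrite addnA leq_add2r; apply: (@leq_trans (3 * K)); last first.
  by rewrite leq_mul2r (leq_trans _ K7) ?orbT.
by rewrite -[K.+1 + K]/(1 + K + K) -addnA mulSn leq_add ?addnn ?mul2n // (leq_trans _ K7).
Qed.

(** * Low-degree extensions and sum-check *)

Section SumCheck.
Local Open Scope ring_scope.
Variables (F : fieldType) (T C : finType) (a : nat).
Variables (row : T -> nat) (col : T -> C).
Hypothesis row_lt : forall e, (row e < a)%N.
Hypothesis row_col_inj : forall e e', row e = row e' -> col e = col e' -> e = e'.
Hypothesis natF_inj : forall i j, (i < a)%N -> (j < a)%N -> i%:R = j%:R :> F -> i = j.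

(* mathcomp's qpoly.lagrange requires an injection of the whole of nat into F,
   so it does not apply to finite fields. *)
Definition lagrange_poly (i : nat) : {poly F} :=
  \prod_(j < a | (j : nat) != i) ((i%:R - j%:R)^-1 *: ('X - j%:R%:P)).

Lemma size_lagrange_poly i : (i < a)%N -> (size (lagrange_poly i) <= a)%N.
Proof.
move=> ia; apply: leq_trans (size_poly_prod_leq _ _) _.
rewrite (eq_bigl (fun j => j != Ordinal ia)) //.
have cA : #|[pred j : 'I_a | j != Ordinal ia]| = a.-1 by rewrite cardC1 card_ord.
have a0 : (0 < a)%N by exact: leq_ltn_trans (leq0n i) ia.
rewrite cA; apply: (@leq_trans ((a.-1 * 2).+1 - a.-1)).
  rewrite leq_sub2r // ltnS -cA -sum_nat_const; apply: leq_sum => j _.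
  by apply: leq_trans (size_scale_leq _ _) _; rewrite size_XsubC.
by rewrite muln2 -addnn -addSn addnK prednK.
Qed.

Lemma horner_lagrange_poly i j : (i < a)%N -> (j < a)%N -> (lagrange_poly i).[j%:R] = (i == j)%:R.
Proof.
move=> ia ja; rewrite horner_prod; case: eqVneq => [<-|ij].
  apply: big1 => l li; rewrite hornerZ hornerXsubC mulVf // subr_eq0.
  by apply: contra li => /eqP/(natF_inj ia (ltn_ord l))->.
rewrite (bigD1 (Ordinal ja)) /= 1?eq_sym //.
by rewrite hornerZ hornerXsubC subrr mulr0 mul0r.
Qed.

(** The low-degree extension, in the row variable, of the multiplicity function of [s], restricted
    to row coordinate [r]. *)
Definition sketch (r : F) (s : seq T) : {ffun C -> F} :=
  [ffun c => \sum_(e <- s | col e == c) (lagrange_poly (row e)).[r]].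

Definition weight_poly (w : T -> F) (c : C) : {poly F} :=
  \sum_(e | col e == c) w e *: lagrange_poly (row e).

Definition sumcheck_poly (s : seq T) (w : T -> F) : {poly F} :=
  \sum_c (\sum_(e <- s | col e == c) lagrange_poly (row e)) * weight_poly w c.

Lemma horner_sumcheck_poly s w r :
  (sumcheck_poly s w).[r] = \sum_c sketch r s c * (weight_poly w c).[r].
Proof.
rewrite horner_sum; apply: eq_bigr => c _.
by rewrite hornerM ffunE horner_sum.
Qed.

Lemma size_sumcheck_poly s w : (size (sumcheck_poly s w) <= (a + a).-1)%N.
Proof.
apply: leq_trans (size_sum _ _ _) _; apply/bigmax_leqP => c _.
apply: leq_trans (size_polyMleq _ _) _; rewrite -!subn1 leq_sub2r // leq_add //.
  apply: leq_trans (size_sum _ _ _) _; apply/bigmax_leqP_seq => e _ _; exact: size_lagrange_poly.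
apply: leq_trans (size_sum _ _ _) _; apply/bigmax_leqP => e _.
by apply: leq_trans (size_scale_leq _ _) _; apply: size_lagrange_poly.
Qed.

(** At a row index each Lagrange polynomial is an indicator, so the product for a column gives each
    token of [s] in that cell the weight of the cell's only element. The rows together visit each
    token once. *)
Lemma sum_sumcheck_poly s w : \sum_(i < a) (sumcheck_poly s w).[i%:R] = \sum_(e <- s) w e.
Proof.
have E (i : 'I_a) : (sumcheck_poly s w).[i%:R] = \sum_(e <- s) (row e == i)%:R * w e.
  rewrite horner_sumcheck_poly.
  transitivity (\sum_c \sum_(e <- s | col e == c) (row e == i)%:R * (weight_poly w c).[i%:R]).
    apply: eq_bigr => c _; rewrite ffunE mulr_suml; apply: eq_bigr => e _.
    by rewrite horner_lagrange_poly.
  rewrite (exchange_big_dep xpredT) //=; apply: eq_bigr => e _.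
  rewrite (big_pred1 (col e)); last by move=> c /=; rewrite eq_sym.
  case: eqP => [re|]; last by rewrite !mul0r.
  rewrite !mul1r horner_sum (bigD1 e) //= hornerZ horner_lagrange_poly // re eqxx mulr1.
  rewrite big1 ?addr0 // => e' /andP[/eqP ce ne]; rewrite hornerZ horner_lagrange_poly //.
  case: eqP => [re'|]; last by rewrite mulr0.
  by rewrite (row_col_inj (etrans re' (esym re)) ce) eqxx in ne.
rewrite (eq_bigr _ (fun i _ => E i)) exchange_big /=; apply: eq_bigr => e _.
rewrite -mulr_suml (bigD1 (Ordinal (row_lt e))) //= eqxx big1 ?addr0 ?mul1r //.
by move=> i; rewrite -val_eqE /= eq_sym => /negbTE->.
Qed.

(** Linearity in the stream is what allows the update token by token. *)
Lemma sketch_rcons r s e :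
  sketch r (rcons s e) =
  [ffun c => sketch r s c + (col e == c)%:R * (lagrange_poly (row e)).[r]].
Proof.
apply/ffunP => c; rewrite !ffunE -cats1 big_cat big_cons big_nil /=.
by case: eqP => _ /=; rewrite addr0 ?mul1r ?mul0r ?addr0.
Qed.

End SumCheck.

Lemma card_poly_agree (F : finFieldType) (d : nat) (p q : {poly F}) :
  size p <= d -> size q <= d -> p != q -> #|[set r : F | (p.[r] == q.[r])%R]| < d.
Proof.
move=> pd qd pq; set A := [set _ | _].
have pq0 : (p - q != 0)%R by rewrite subr_eq0.
have := @max_poly_roots _ (p - q)%R (enum A) pq0.
rewrite enum_uniq -cardE => H; apply: leq_trans (H _ isT) _.
  apply/allP => r; rewrite mem_enum inE => /eqP e.
  by rewrite /root hornerD hornerN e subrr.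
by apply: leq_trans (size_polyD _ _) _; rewrite geq_max size_polyN pd.
Qed.

(** * Encoding finite data as bit strings *)

Lemma injection_of_card_leq (A B : finType) :
  #|A| <= #|B| -> exists f : A -> B, injective f.
Proof.
move=> AB; exists (fun x => enum_val (widen_ord AB (enum_rank x))).
by move=> x y /enum_val_inj/(congr1 val)/= /val_inj/enum_rank_inj.
Qed.

Lemma bit_encoding (A : finType) (k : nat) : #|A| <= 2 ^ k ->
  exists (enc : A -> seq bool) (dec : seq bool -> option A),
    (forall x, size (enc x) = k) /\ pcancel enc dec.
Proof.
rewrite -card_bool -card_tuple => /injection_of_card_leq[f fI].
exists (fun x => tval (f x)), (fun bs => [pick x | tval (f x) == bs]).
split=> [x|x]; first exact: size_tuple.
case: pickP => [y /eqP/val_inj/fI-> //|/(_ x)]; by rewrite eqxx.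
Qed.

(** Fixed-width blocks of [k] bits. Undecodable blocks are skipped and an incomplete last block is
    ignored, so even a dishonest help message decodes to some sequence. *)
Lemma bit_encoding_seq (A : finType) (k : nat) : 0 < k -> #|A| <= 2 ^ k ->
  exists (enc : seq A -> seq bool) (dec : seq bool -> seq A),
    (forall s, size (enc s) = k * size s) /\ cancel enc dec.
Proof.
move=> k0 /bit_encoding[enc [dec [sz encK]]].
exists (fun s => flatten (map enc s)),
  (fun bs => pmap dec (reshape (nseq (size bs %/ k) k) bs)).
have sh s : shape (map enc s) = nseq (size s) k.
  by elim: s => //= x s ->; rewrite sz.
have sz' s : size (flatten (map enc s)) = k * size s.
  by rewrite size_flatten sh sumn_nseq.
split=> // s; rewrite sz' mulKn // -sh flattenK.
exact: map_pK.
Qed.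

(** * The certificate and its verification *)

Lemma simple_graph_edgeset n (s : seq (edge_tok n)) :
  valid_stream s -> simple_graph (edgeset s).
Proof.
move=> /andP[/allP loopless _] e; rewrite inE => /mapP[t ts ->].
by rewrite cards2 loopless.
Qed.

Lemma max_matchingE n (s : seq (edge_tok n)) :
  max_matching s = matching_number (edgeset s).
Proof. by []. Qed.

Lemma card_edgeset n (s : seq (edge_tok n)) :
  valid_stream s -> #|edgeset s| = size s.
Proof.
by move=> /andP[_ u]; rewrite cardsE (card_uniqP u) size_map.
Qed.

Lemma valid_stream_uniq n (s : seq (edge_tok n)) : valid_stream s -> uniq s.
Proof. by move=> /andP[_ /map_uniq]. Qed.

Lemma valid_stream_filter n (P : pred (edge_tok n)) s :
  valid_stream s -> valid_stream (filter P s).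
Proof.
move=> /andP[/allP nl u]; apply/andP; split.
  by apply/allP => e; rewrite mem_filter => /andP[_ /nl].
by apply: subseq_uniq u; apply: map_subseq; exact: filter_subseq.
Qed.

Lemma valid_stream_size n (s : seq (edge_tok n)) : valid_stream s -> size s <= n ^ 2.
Proof.
move=> /valid_stream_uniq/card_uniqP <-; apply: leq_trans (max_card _) _.
by rewrite card_prod card_ord mulnn.
Qed.

Lemma covered_sym n U (L : 'I_n -> 'I_n) x y : covered U L x y = covered U L y x.
Proof. by rewrite /covered eq_sym orbCA. Qed.

(** This bounds the number of labels to be sent. As [L] is idempotent, a nonempty class contains its
    own label, so a class of size m has m - 1 other vertices, and m - 1 <= 2 floor(m/2). *)
Lemma sum_not_fixed n (L : 'I_n -> 'I_n) : (forall x, L (L x) = L x) ->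
  #|[set x | L x != x]| <= 2 * \sum_l #|[set x | L x == l]| %/ 2.
Proof.
move=> LL; rewrite -sum1_card (partition_big L predT) //= big_distrr /=.
apply: leq_sum => l _; set C := [set x | L x == l].
have [lC|lC] := boolP (l \in C); last first.
  rewrite big1 // => x /andP[_ /eqP Lx].
  by move: lC; rewrite inE -Lx LL eqxx.
apply: (@leq_trans #|C :\ l|).
  rewrite sum1dep_card; apply/subset_leq_card/subsetP => x; rewrite !inE.
  by move=> /andP[Lx /eqP Lxl]; rewrite Lxl eqxx andbT -Lxl eq_sym.
have := cardsD1 l C; rewrite lC add1n => ->.
move: #|_ :\ l| => m; by rewrite divn2 mul2n -leq_uphalf_double.
Qed.

Lemma count_sum (T : Type) (P : pred T) (s : seq T) :
  count P s = \sum_(x <- s) P x.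
Proof. by elim: s => [|x s IH] /=; rewrite ?big_nil // big_cons IH. Qed.

Section Check.
Local Open Scope ring_scope.
Variables (n b : nat) (F : finFieldType) (b_gt0 : (0 < b)%N).

(** The summands are, in order: a vertex of U, an edge of M, a vertex with its label, a coefficient
    of q. *)
Definition item : finType := (('I_n + edge_tok n) + (edge_tok n + F))%type.

Definition dominators (w : seq item) : {set 'I_n} := [set x | inl (inl x) \in w].

Definition matched (w : seq item) : seq (edge_tok n) :=
  pmap (fun i : item => if i is inl (inr e) then Some e else None) w.

Definition relabelled (w : seq item) : seq (edge_tok n) :=
  pmap (fun i : item => if i is inr (inl e) then Some e else None) w.

(* Vertices without an explicit label form singleton classes. *)
Definition labelling (w : seq item) (x : 'I_n) : 'I_n :=
  head x [seq e.2 | e <- relabelled w & e.1 == x].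

Definition claimed_poly (w : seq item) : {poly F} :=
  Poly (pmap (fun i : item => if i is inr (inr c) then Some c else None) w).

Definition nrows := (n.-1 %/ b).+1.
Definition tok_row (e : edge_tok n) : nat := e.1 %/ b.
Definition tok_col (e : edge_tok n) : 'I_b * 'I_n := (Ordinal (ltn_pmod e.1 b_gt0), e.2).

(* Over a stream s, the weights add up to
   #{uncovered edges of s} + #{claimed edges not in s} - #{claimed edges}. *)
Definition weight (w : seq item) (e : edge_tok n) : F :=
  (~~ covered (dominators w) (labelling w) e.1 e.2)%:R - (e \in matched w)%:R.

(** The tests that need only the help message. The last one makes the claimed polynomial assert that
    the number of violations, as counted by [weight] plus #|M|, is zero. *)
Definition static_check (w : seq item) : bool :=
  [&& valid_stream (matched w), trivIset (edgeset (matched w)),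
      size (matched w) == cover_value (dominators w) (labelling w),
      (size (claimed_poly w) <= (nrows + nrows).-1)%N &
      \sum_(i < nrows) (claimed_poly w).[i%:R] + (size (matched w))%:R == 0].

Definition sketch_check (r : F) (sk : {ffun 'I_b * 'I_n -> F}) (w : seq item) : bool :=
  (claimed_poly w).[r] ==
    \sum_c sk c * (weight_poly nrows tok_row tok_col (weight w) c).[r].

(** Each of the two violation counts is at most n^2, so their sum vanishes in [F] only if it is
    0. *)
Hypothesis natF_inj : forall i j, (i <= n ^ 2 + n ^ 2)%N -> (j <= n ^ 2 + n ^ 2)%N ->
  i%:R = j%:R :> F -> i = j.

Lemma tok_row_lt e : (tok_row e < nrows)%N.
Proof. by rewrite ltnS leq_div2r // -ltnS prednK // (leq_ltn_trans _ (ltn_ord e.1)). Qed.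

Lemma tok_row_col_inj e e' : tok_row e = tok_row e' -> tok_col e = tok_col e' -> e = e'.
Proof.
case: e e' => [x y] [x' y'] /= Er [Ec ->]; congr (_, _); apply: val_inj => /=.
by rewrite (divn_eq x b) (divn_eq x' b) Ec; congr (_ * _ + _)%N.
Qed.

Lemma nrows_natF_inj i j : (i < nrows)%N -> (j < nrows)%N -> i%:R = j%:R :> F -> i = j.
Proof.
have le : (nrows.-1 <= n ^ 2 + n ^ 2)%N.
  apply: leq_trans (leq_div _ _) _; apply: leq_trans (leq_pred _) _.
  by apply: leq_trans (leq_addr _ _); case: (n) => // m; rewrite -mulnn leq_pmulr.
by move=> i1 j1; apply: natF_inj; apply: leq_trans le.
Qed.

(** Neither sequence repeats a token, so summing membership in [matched w] over [s] counts the
    claimed tokens present in [s]; subtracting this from the total leaves the absent ones. *)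
Lemma sum_weight (s : seq (edge_tok n)) w :
  valid_stream s -> valid_stream (matched w) ->
  \sum_(e <- s) weight w e + (size (matched w))%:R =
  (count (fun e => ~~ covered (dominators w) (labelling w) e.1 e.2) s +
   count (predC (mem s)) (matched w))%:R.
Proof.
move=> vs vM; rewrite sumrB -!natr_sum -addrA natrD; congr (_ + _).
  by rewrite count_sum.
rewrite -(count_predC (mem s) (matched w)) natrD addrA addrC.
suff -> : count (mem s) (matched w) = (\sum_(e <- s) (e \in matched w))%N.
  by rewrite addNr addr0.
rewrite -!size_filter; transitivity (size (filter (mem (matched w)) s)).
  apply: perm_size; apply: uniq_perm; rewrite ?filter_uniq ?valid_stream_uniq //.
  by move=> e; rewrite !mem_filter andbC.
by rewrite size_filter count_sum.
Qed.

(** If the claimed polynomial were the true one, the sum test would exclude all violations: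
    [matched w] would be a matching of the graph, and the cover would bound every matching by its
    size. So a wrong size forces two different polynomials, which agree at few points. *)
Lemma check_sound (s : seq (edge_tok n)) w :
  valid_stream s -> static_check w -> size (matched w) != max_matching s ->
  (#|[set r | sketch_check r (sketch nrows tok_row tok_col r s) w]| < (nrows + nrows).-1)%N.
Proof.
move=> vs /and5P[vM tM /eqP sz szQ /eqP sumQ] ne.
under eq_finset => r do rewrite /sketch_check -horner_sumcheck_poly.
apply: card_poly_agree => //; first by apply: size_sumcheck_poly; exact: tok_row_lt.
apply/eqP => EQ; move: sumQ; rewrite EQ.
rewrite sum_sumcheck_poly; [|exact: tok_row_lt|exact: tok_row_col_inj|exact: nrows_natF_inj].
rewrite sum_weight // => /(@natF_inj _ 0%N) H0.
have {H0} /eqP := H0 (leq_add (leq_trans (count_size _ _) (valid_stream_size vs))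
  (leq_trans (count_size _ _) (valid_stream_size vM))) isT.
rewrite addn_eq0 !eqn0Ngt -!has_count => /andP[/hasPn cov /hasPn sub].
move/eqP: ne; apply; apply/eqP; rewrite eqn_leq; apply/andP; split.
  rewrite -(card_edgeset vM); apply: leq_matching_number.
  rewrite is_matchingE tM andbT; apply/subsetP => e; rewrite !inE => /mapP[t tM' ->].
  by apply: map_f; have := sub _ tM'; rewrite /= negbK.
have [M /andP[mM /eqP eM]] := maximum_matching_exists (edgeset s).
rewrite max_matchingE -eM sz.
apply: (leq_cover_value (simple_graph_edgeset vs)) mM => x y.
rewrite inE => /mapP[[u v] ts E]; have := cov _ ts; rewrite negbK /=.
have : x \in tok_set (u, v) by rewrite -E !inE eqxx.
have : y \in tok_set (u, v) by rewrite -E !inE eqxx orbT.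
have : v \in [set x; y] by rewrite E !inE eqxx orbT.
have : u \in [set x; y] by rewrite E !inE eqxx.
rewrite !inE /= => /orP[]/eqP-> /orP[]/eqP->; rewrite ?eqxx ?orbT //.
- by move=> /orP[]/eqP-> _.
- by rewrite covered_sym.
- by move=> _ /orP[]/eqP->.
Qed.

Lemma check_complete (s : seq (edge_tok n)) : valid_stream s ->
  exists w : seq item,
    [/\ static_check w, size (matched w) = max_matching s,
        (size w <= 3 * max_matching s + (nrows + nrows).-1)%N &
        forall r, sketch_check r (sketch nrows tok_row tok_col r s) w].
Proof.
move=> vs; have gE := simple_graph_edgeset vs.
have [U [L [cov valE LL]]] := tutte_berge gE.
have [M0 /andP[mM0 /eqP sM0]] := maximum_matching_exists (edgeset s).
have /andP[/subsetP M0E tM0] : (M0 \subset edgeset s) && trivIset M0 by rewrite -is_matchingE.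
(* Filtering the stream itself gives the claimed edges the orientation they have there; [weight]
   compares oriented tokens. *)
pose M := [seq e <- s | tok_set e \in M0].
have vM : valid_stream M by apply: valid_stream_filter.
have EM : edgeset M = M0.
  apply/setP => e; rewrite inE; apply/mapP/idP => [[t]|eM].
    by rewrite mem_filter => /andP[tM _] ->.
  have := M0E _ eM; rewrite inE => /mapP[t ts et].
  by exists t => //; rewrite mem_filter -et eM.
have szM : size M = max_matching s by rewrite -(card_edgeset vM) EM.
(* The honest q depends on the weights, hence on the message that contains it. The weights ignore
   the coefficients, so q can be computed from [w0 [::]]. *)
pose w0 q : seq item := [seq inl (inl x) | x <- enum U] ++ [seq inl (inr e) | e <- M] ++
  [seq inr (inl (x, L x)) | x <- enum [set x | L x != x]] ++ [seq inr (inr c) | c <- q].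
have pmap0 (A B D : Type) (f : B -> option D) (g : A -> B) l :
    (forall x, f (g x) = None) -> pmap f (map g l) = [::].
  by move=> fg; elim: l => //= x l ->; rewrite fg.
have dU q : dominators (w0 q) = U.
  apply/setP => x; rewrite inE !mem_cat; apply/or4P/idP => [[]|xU]; last first.
    by apply: Or41; apply: map_f; rewrite mem_enum.
  - by case/mapP.
  - by case/mapP.
  - by case/mapP.
  - by case/mapP => y; rewrite mem_enum => yU [->].
have dM q : matched (w0 q) = M.
  by rewrite /matched !pmap_cat pmap0 // map_pK // !pmap0 // !cats0.
have dL q : labelling (w0 q) =1 L.
  move=> x; rewrite /labelling /relabelled !pmap_cat pmap0 // pmap0 //.
  rewrite (map_comp (fun e : edge_tok n => inr (inl e)) (fun x => (x, L x))) map_pK // pmap0 // cats0 /=.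
  rewrite filter_map -map_comp /=; case: (eqVneq (L x) x) => [Lx|Lx].
    rewrite (eq_in_filter (a2 := pred0)) ?filter_pred0 // => y.
    by rewrite mem_enum inE /= => Ly; apply: contra_neqF Ly => /eqP->.
  by rewrite (filter_pred1_uniq (enum_uniq _)) // mem_enum inE.
have cv q : cover_value (dominators (w0 q)) (labelling (w0 q)) = cover_value U L.
  rewrite /cover_value dU; congr (_ + _)%N; apply: eq_bigr => l _.
  by congr (_ %/ _)%N; apply: eq_card => x; rewrite !inE dL.
have we q e : weight (w0 q) e = weight (w0 [::]) e by rewrite /weight /covered !dU !dM !dL.
pose Q := sumcheck_poly nrows tok_row tok_col s (weight (w0 [::])).
have dQ : claimed_poly (w0 Q) = Q.
  by rewrite /claimed_poly !pmap_cat pmap0 // pmap0 // pmap0 // map_pK // polyseqK.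
have dW e : weight (w0 Q) e = weight (w0 [::]) e := we _ e.
exists (w0 Q); rewrite !dM; split => //.
- rewrite /static_check !dM EM vM tM0 dQ cv szM -valE eqxx /=.
  rewrite size_sumcheck_poly /=; last exact: tok_row_lt.
  rewrite sum_sumcheck_poly; [|exact: tok_row_lt|exact: tok_row_col_inj|exact: nrows_natF_inj].
  rewrite -szM -(dM [::]) sum_weight ?dM //.
  set N := (_ + _)%N; suff -> : N = 0%N by []; apply/eqP; rewrite /N {N}.
  rewrite addn_eq0 !eqn0Ngt -!has_count; apply/andP; split.
    apply/hasPn => e es; rewrite negbK /covered dU !dL.
    by apply: cov; rewrite inE; apply: map_f.
  by apply/hasPn => e; rewrite mem_filter /= negbK => /andP[].
(* With alpha' = #|U| + S, where S sums the halved class sizes, the edges, the vertices of U and at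
   most 2S labels number at most alpha' + #|U| + 2S <= 3 alpha'. *)
- have szQ : (size Q <= (nrows + nrows).-1)%N by apply: size_sumcheck_poly; exact: tok_row_lt.
  move: (nrows + nrows).-1 szQ => d szQ.
  rewrite !size_cat !size_map -!cardE szM !addnA leq_add //.
  have := sum_not_fixed LL; have : max_matching s = cover_value U L by [].
  rewrite /cover_value; move: (\sum_l _)%N => S -> H.
  apply: leq_trans (leq_add (leqnn _) H) _.
  by rewrite addnA addnn -addnA -mulSn mulnDr leq_add2r -mul2n leq_mul2r orbT.
- move=> r; rewrite /sketch_check dQ horner_sumcheck_poly; apply/eqP; apply: eq_bigr => c _.
  congr (_ * _.[_]); apply: eq_bigr => e _; by rewrite dW.
Qed.

End Check.

(** * The Verifier *)

Lemma max_matching_leq n (s : seq (edge_tok n)) : valid_stream s -> max_matching s <= n.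
Proof.
move=> vs; have [M /andP[mM /eqP eM]] := maximum_matching_exists (edgeset s).
rewrite max_matchingE -eM; have := max_card (mem (cover M)).
rewrite (card_cover_matching (simple_graph_edgeset vs) mM) card_ord.
by apply: leq_trans; rewrite leq_pmull.
Qed.

Lemma nrows_leq n b : 0 < n -> nrows n b <= n.
Proof. by move=> n0; rewrite /nrows -{2}(prednK n0) ltnS leq_div. Qed.

(** The cap protects the space bound against overlong help messages, whose excess bits are
    dropped. *)
Lemma foldl_capped_rcons (cap : nat) (st hm : seq bool) :
  foldl (fun st c => if size st < cap then rcons st c else st) st hm =
  st ++ take (cap - size st) hm.
Proof.
elim: hm st => [|c hm IH] st /=; first by rewrite cats0.
rewrite IH; case: ltnP => [lt|le].
  by rewrite size_rcons cat_rcons subnS -[cap - size st]prednK ?subn_gt0.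
by move: le; rewrite -subn_eq0 => /eqP->; rewrite take0.
Qed.

(** The length bound leaves finitely many candidate messages, so a help function can be defined by
    search. *)
Lemma help_exists n (f : seq (edge_tok n) -> nat) (V : verifier n)
    (B : seq (edge_tok n) -> nat) :
  (forall s, valid_stream s -> exists2 hm, size hm <= B s &
     forall r, vrun V r s hm = Some (f s)) ->
  exists P, (forall s, valid_stream s -> forall r, vrun V r s (P s) = Some (f s)) /\
            help_within P B.
Proof.
move=> H.
pose P s : seq bool :=
  if [pick w : (B s).-bseq bool | [forall r, vrun V r s w == Some (f s)]] is Some w
  then w else [::].
exists P; split=> [s vs r|s vs]; rewrite /P; case: pickP => [w|//].
- by move=> /forallP/(_ r)/eqP.
- have [hm sz run] := H s vs => /(_ (Bseq sz)); rewrite /= => /negP; case.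
  by apply/forallP => r'; rewrite run.
- by move=> _; apply: size_bseq.
Qed.

(** The secret point is one of 2^k embedded field elements, fewer than 2n of which are bad, so 6n <=
    2^k gives error at most 1/3. As [#|F|] <= 2^(2k+1), a field element takes 2k+1 bits and an
    [item] one more. *)
Lemma scheme_of_field n b k (F : finFieldType) :
  0 < n -> 0 < b -> n ^ 2 + n ^ 2 <= 2 ^ k -> 6 * n <= 2 ^ k ->
  2 ^ k <= #|F| -> #|F| <= 2 ^ k.*2.+1 ->
  (forall i j, i <= 2 ^ k -> j <= 2 ^ k -> (i%:R = j%:R :> F)%R -> i = j) ->
  exists (V : verifier n) (P : seq (edge_tok n) -> seq bool),
    [/\ is_scheme (@max_matching n) V P,
        help_within P (fun s => k.*2.+2 * (3 * max_matching s + 2 * nrows n b)) &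
        space_within V (k.*2.+1 * (1 + b * n) + k.*2.+2 * (5 * n))].
Proof.
move=> n0 b0 n2 n6 Fge Fle natF.
have natF' i j : i <= n ^ 2 + n ^ 2 -> j <= n ^ 2 + n ^ 2 -> (i%:R = j%:R :> F)%R -> i = j.
  by move=> i1 j1; apply: natF; apply: leq_trans n2.
have [emb embI] : exists emb : k.-tuple bool -> F, injective emb.
  by apply: injection_of_card_leq; rewrite card_tuple card_bool.
pose kS := k.*2.+1 * (1 + b * n); pose kW := k.*2.+2.
have [encS [decS [szS encSK]]] :
    exists (enc : F * {ffun 'I_b * 'I_n -> F} -> seq bool) dec,
      (forall x, size (enc x) = kS) /\ pcancel enc dec.
  apply: bit_encoding; rewrite card_prod card_ffun card_prod !card_ord /kS.
  by rewrite add1n -expnS [X in _ <= X]expnM leq_exp2r.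
have [encW [decW [szW encWK]]] :
    exists (enc : seq (item n F) -> seq bool) dec,
      (forall w, size (enc w) = kW * size w) /\ cancel enc dec.
  apply: bit_encoding_seq => //; rewrite !card_sum !card_prod !card_ord mulnn /kW.
  have le : n + n ^ 2 + n ^ 2 <= 2 ^ k.*2.+1.
    apply: (@leq_trans (2 ^ k.+1)); last by rewrite leq_exp2l // ltnS -addnn leq_addr.
    by rewrite [2 ^ _.+1]expnS mul2n -addnn -addnA leq_add // (leq_trans _ n6) // leq_pmull.
  by rewrite addnA [2 ^ _.+1]expnS mul2n -addnn leq_add.
(* Room for 5n items never truncates an honest message, since alpha' and [nrows n b] are both at
   most n. *)
pose cap := kS + kW * (5 * n).
pose R := @tok_row n b; pose C := @tok_col n b b0; pose a := nrows n b.
pose step (st : seq bool) e := if decS st is Some (r, sk) then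
  encS (r, [ffun c => sk c + (C e == c)%:R * (lagrange_poly F a (R e)).[r]]%R) else st.
pose init r := encS (emb r, sketch a R C (emb r) [::]).
pose help (st : seq bool) (c : bool) := if size st < cap then rcons st c else st.
pose out st := if decS (take kS st) is Some (r, sk) then
    let w := decW (drop kS st) in
    if static_check b w && sketch_check b0 r sk w then Some (size (matched w)) else None
  else None.
pose V := @Verifier n k init step help out.
have stS r s : foldl step (init r) s = encS (emb r, sketch a R C (emb r) s).
  elim/last_ind: s => // s e IH.
  by rewrite foldl_rcons IH /step encSK sketch_rcons.
have stV (r : (seedlen V).-tuple bool) s hm :
    vstate V r s hm = encS (emb r, sketch a R C (emb r) s) ++ take (cap - kS) hm.
  by rewrite /vstate /= foldl_capped_rcons stS szS.
have runV (r : (seedlen V).-tuple bool) s hm : let w := decW (take (cap - kS) hm) in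
    vrun V r s hm = if static_check b w && sketch_check b0 (emb r) (sketch a R C (emb r) s) w
                    then Some (size (matched w)) else None.
  move=> w; rewrite /vrun stV /= /out take_size_cat // encSK.
  by rewrite drop_size_cat.
have [|P [runP szP]] := @help_exists n (@max_matching n) V
  (fun s => k.*2.+2 * (3 * max_matching s + 2 * nrows n b)).
  move=> s vs; have [w [st sz szw dyn]] := check_complete b0 natF' vs.
  have szw' : size w <= 3 * max_matching s + 2 * nrows n b.
    apply: leq_trans szw _; rewrite leq_add2l mul2n -addnn; exact: leq_pred.
  exists (encW w); first by rewrite szW leq_mul2l szw' orbT.
  move=> r; rewrite runV take_oversize; first by rewrite encWK st dyn sz.
  rewrite szW /cap addKn leq_mul2l; apply/orP; right; apply: leq_trans szw' _.
  have := nrows_leq b n0; have := max_matching_leq vs.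
  move: (max_matching s) (nrows n b); lia.
exists V, P; split=> //.
- split=> // s vs hm; set w := decW (take (cap - kS) hm).
  (* An error needs a statically valid message with the wrong size; otherwise the output is correct
     or a rejection. *)
  case: (boolP (static_check b w && (size (matched w) != max_matching s))) => [/andP[st ne]|bad].
    have := check_sound b0 natF' vs st ne.
    set A := [set _ | _] => szA; set B := [set _ | _].
    have BA : #|B| <= #|A|.
      rewrite -(card_imset _ embI); apply/subset_leq_card/subsetP => x /imsetP[r + ->].
      by rewrite !inE runV -/w st /=; case: ifP => //; rewrite andbF.
    have := leq_trans BA (ltnW szA); have := nrows_leq b n0; move: n6.
    move: #|B| (nrows n b) (2 ^ k) => x y z.
    rewrite /=; lia.
  rewrite (_ : [set _ | _] = set0) ?cards0 ?muln0 //; apply/setP => r; rewrite !inE runV -/w.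
  case: ifP => [/andP[st _]|_]; last by rewrite andbF.
  move: bad; rewrite st /= negbK => /eqP->; by rewrite eqxx.
- move=> s vs hm r i j; rewrite stV size_cat szS -/kS -/kW leq_add2l size_take_min.
  by rewrite (leq_trans (geq_minl _ _)) // /cap addKn.
Qed.

(** * Choice of the parameters *)

Lemma leq_nrows n h b : 0 < b -> 0 < h -> n <= 2 * h * b -> nrows n b <= 3 * h.
Proof.
move=> b0 h0 nb; rewrite /nrows.
have : n.-1 %/ b <= 2 * h.
  by rewrite -[X in _ <= X](mulnK _ b0) leq_div2r // (leq_trans (leq_pred n)).
lia.
Qed.

Lemma scheme_with_tradeoff n h v : n ^ 2 <= h * v -> n <= v ->
  exists (V : verifier n) (P : seq (edge_tok n) -> seq bool),
    [/\ is_scheme (@max_matching n) V P,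
        help_within P (fun s => 60 * (max_matching s + h) * polylog 1 n) &
        space_within V (100 * v * polylog 1 n)].
Proof.
case: (posnP n) => [-> _ _|n0 hv nv].
  pose V := @Verifier 0 0 (fun=> [::]) (fun st _ => st) (fun st _ => st) (fun=> Some 0).
  have m0 (s : seq (edge_tok 0)) : valid_stream s -> max_matching s = 0.
    by move/max_matching_leq; rewrite leqn0 => /eqP.
  have stV (r : (seedlen V).-tuple bool) s hm : vstate V r s hm = [::].
    by rewrite /vstate /=; elim: s => //; elim: hm.
  exists V, (fun=> [::]); split=> //; last by move=> s _ hm r i j; rewrite stV.
  split=> [s /m0-> //|s vs hm].
  rewrite (_ : [set _ | _] = set0) ?cards0 //; apply/setP => r.
  by rewrite !inE m0.
have b0 : 0 < v %/ n by rewrite divn_gt0.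
set b := v %/ n in b0.
have h0 : 0 < h by case: h hv => //; rewrite mul0n leqn0 expn_eq0 -leqn0 leqNgt n0.
(* From v < (b+1)n and n^2 <= hv follows n <= h(b+1), and b+1 <= 2b. *)
have nb : n <= 2 * h * b.
  have vlt : v < b.+1 * n by rewrite -ltn_divLR.
  have : n * n <= h * b.+1 * n by rewrite mulnn -mulnA (leq_trans hv) // leq_mul2l ltnW ?orbT.
  rewrite leq_mul2r -[n == 0]negbK -lt0n n0 /= => /leq_trans; apply.
  by rewrite -mulnA mulnCA leq_mul2l mul2n -addnn -add1n leq_add2r b0 orbT.
have a3 := leq_nrows b0 h0 nb.
(* As n < 2^(t+1), the number 2^k = 4 (2^(t+1))^2 exceeds both 2n^2 and 6n, while k stays O(log
   n). *)
set t := trunc_log 2 n; pose k := t.*2 + 4.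
have nt : n < 2 ^ t.+1 by apply: trunc_log_ltn.
have nk : n ^ 2 + n ^ 2 <= 2 ^ k /\ 6 * n <= 2 ^ k.
  have E : 2 ^ k = 4 * (2 ^ t.+1 * 2 ^ t.+1) by rewrite /k -addnn !expnD !expnS; lia.
  have := expn_gt0 2 t; rewrite E -mulnn expnS /=; move: nt; rewrite expnS.
  move: (2 ^ t) => x nt x0; split; nia.
(* The bounds 2^k and 2 (2^k)^2 = 2^(2k+1) are those required of the field size. *)
have [|p /and3P[pp kp p2]] := @prime_below_double_square (2 ^ k).
  by rewrite /k (@leq_trans (2 ^ 4)) // leq_exp2l // leq_addl.
have [|||V [P [sch hp sp]]] := @scheme_of_field n b k 'F_p n0 b0 (proj1 nk) (proj2 nk).
- by rewrite card_Fp // ltnW.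
- by rewrite card_Fp // -muln2 expnS expnM mul2n.
- move=> i j ik jk /(congr1 (@nat_of_ord _)); rewrite !val_Fp_nat // !modn_small //.
    exact: leq_ltn_trans kp.
  exact: leq_ltn_trans kp.
exists V, P; split=> //.
- move=> s vs; apply: leq_trans (hp s vs) _.
  rewrite /polylog expn1 -/t /k; move: (max_matching s) (nrows n b) a3 => x y; nia.
- move=> s vs hm r i j; apply: leq_trans (sp s vs hm r i j) _.
  have bn : b * n <= v by apply: leq_trunc_div.
  rewrite /polylog expn1 -/t /k; move: (b * n) bn => y yv.
  nia.
Qed.

(** In the second clause [a] is a guess for alpha' fixed in advance, because the space bound cannot
    depend on the stream; whenever a <= alpha', the help is O(alpha') up to logarithms. *)
Theorem theorem4p4 :
  exists C c : nat,
    (forall n h v : nat, n ^ 2 <= h * v -> n <= v ->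
       exists (V : verifier n) (P : seq (edge_tok n) -> seq bool),
         [/\ is_scheme (@max_matching n) V P,
             help_within P (fun s => C * (max_matching s + h) * polylog c n)
           & space_within V (C * v * polylog c n)]) /\
    (forall n a : nat, 0 < a -> a <= n ->
       exists (V : verifier n) (P : seq (edge_tok n) -> seq bool),
         [/\ is_scheme (@max_matching n) V P,
             help_within P (fun s => C * (max_matching s + a) * polylog c n)
           & space_within V (C * (n ^ 2 %/ a) * polylog c n)]).
Proof.
exists 120, 1; split=> [n h v hv nv|n a a0 an].
  have [V [P [sch hp sp]]] := scheme_with_tradeoff hv nv.
  exists V, P; split=> // [s vs|s vs hm r i j].
    by apply: leq_trans (hp s vs) _; rewrite !leq_mul.
  by apply: leq_trans (sp s vs hm r i j) _; rewrite !leq_mul.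
have nv : n <= n ^ 2 %/ a by rewrite leq_divRL // -mulnn leq_mul2l an orbT.
(* Rounding n^2/a down loses at most a factor 2, as the quotient is positive. Taking h = 2a
   compensates and doubles the help constant 60 to 120. *)
have hv : n ^ 2 <= 2 * a * (n ^ 2 %/ a).
  have lt : n ^ 2 < (n ^ 2 %/ a).+1 * a by rewrite -ltn_divLR.
  have q0 : 0 < n ^ 2 %/ a by apply: leq_trans nv; apply: leq_trans an.
  move: (n ^ 2) (n ^ 2 %/ a) lt q0 => x y; nia.
have [V [P [sch hp sp]]] := scheme_with_tradeoff hv nv.
exists V, P; split=> // [s vs|s vs hm r i j].
  apply: leq_trans (hp s vs) _; rewrite leq_mul2r; apply/orP; right.
  by move: (max_matching s) => x; lia.
by apply: leq_trans (sp s vs hm r i j) _; rewrite !leq_mul.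
Qed.
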